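(* Let $x_0>0$ and $\mathcal A_0>\frac32\pi x_0^2$, let $L=L(x_0,\mathcal A_0)$, $\gamma=\gamma(x_0,L)$ with unit normal $N$, and $\lambda=\lambda(x_0,L)$. There exists $\varepsilon=\varepsilon(x_0,\mathcal A_0)>0$ such that for every $\varphi\in\mathcal W_1\cap C^2[0,2L]$ with $\varphi\not\equiv0$ and $\|\varphi\|_{C^2[0,2L]}\le\varepsilon$, $$(\mathcal F-\lambda\mathcal A)(\gamma)<(\mathcal F-\lambda\mathcal A)(\gamma+\varphi N).$$ In particular, if in addition $\mathcal A(\gamma+\varphi N)=\mathcal A(\gamma)$, then $\mathcal F(\gamma)<\mathcal F(\gamma+\varphi N)$.
   Context: Notation: $(\xi,\eta)^\perp=(\eta,-\xi)$. For a regular curve $\eta=(\eta_1,\eta_2)\in C^2([0,2L],\mathbb R^2)$ with $\langle\dot\eta,\ddot\eta^\perp\rangle>0$, set $\mathcal F(\eta)=\int_0^{2L}\frac{|\dot\eta|^4}{\langle\dot\eta,\ddot\eta^\perp\rangle}ds$ (equal to $\int_0^{2L}|\dot\eta|H^{-1}ds$ with curvature $H=\langle\dot\eta,\ddot\eta^\perp\rangle/|\dot\eta|^3$) and $\mathcal A(\eta)=\frac12\int_0^{2L}(\eta_1\dot\eta_2-\dot\eta_1\eta_2)ds$. For $0<3x_0<L$: $\lambda(x_0,L)=\frac{2L}{L+x_0}$; with $\sigma=\pi\sqrt{x_0/(L+x_0)}$, $k=L/\sin\sigma$, $a(s)=\arcsin((s-L)/k)$, $\gamma(x_0,L)=(x,y)$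 on $[0,2L]$ with $x(s)=-\frac k2\big(\frac{\sigma}{\pi+\sigma}\sin(\tfrac{\pi+\sigma}{\sigma}a(s))+\frac{\sigma}{\pi-\sigma}\sin(\tfrac{\pi-\sigma}{\sigma}a(s))\big)$, $y(s)=\frac k2\big(\frac{\sigma}{\pi+\sigma}\cos(\tfrac{\pi+\sigma}{\sigma}a(s))+\frac{\sigma}{\pi-\sigma}\cos(\tfrac{\pi-\sigma}{\sigma}a(s))\big)+\frac{\pi x_0}{\sigma\tan\sigma}$; it is arc-length parametrized with $N=\dot\gamma^\perp$ and positive curvature. For $\mathcal A_0>\frac32\pi x_0^2$, $L(x_0,\mathcal A_0)$ is the unique $L>3x_0$ with $\mathcal A(\gamma(x_0,L))=\mathcal A_0$. $\mathcal W_1=\{\varphi\in W^{2,2}(0,2L):\varphi(0)=\varphi(2L)=0,\ \dot\varphi(0)=\dot\varphi(2L)=0\}$. *)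

(* Defs.v *)
From Stdlib Require Import Reals.
From Coquelicot Require Import Coquelicot.
Open Scope R_scope.

Definition sigma (x0 L : R) : R := PI * sqrt (x0 / (L + x0)).
Definition kpar (x0 L : R) : R := L / sin (sigma x0 L).
Definition apar (x0 L s : R) : R := asin ((s - L) / kpar x0 L).

Definition lambda (x0 L : R) : R := 2 * L / (L + x0).

Definition gx (x0 L : R) (s : R) : R :=
  let sg := sigma x0 L in let k := kpar x0 L in let a := apar x0 L s in
  - (k / 2) * (sg / (PI + sg) * sin ((PI + sg) / sg * a)
              + sg / (PI - sg) * sin ((PI - sg) / sg * a)).

Definition gy (x0 L : R) (s : R) : R :=
  let sg := sigma x0 L in let k := kpar x0 L in let a := apar x0 L s in
  (k / 2) * (sg / (PI + sg) * cos ((PI + sg) / sg * a)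
            + sg / (PI - sg) * cos ((PI - sg) / sg * a))
  + PI * x0 / (sg * tan sg).

(* F(eta) = int_0^{2L} |eta'|^4 / <eta', eta''^perp> ds, with (a,b)^perp = (b,-a),
   so <eta', eta''^perp> = eta1' eta2'' - eta2' eta1''. *)
Definition Fcal (L : R) (e1 e2 : R -> R) : R :=
  RInt (fun s =>
          let d1 := Derive e1 s in let d2 := Derive e2 s in
          let dd1 := Derive (Derive e1) s in let dd2 := Derive (Derive e2) s in
          (d1 ^ 2 + d2 ^ 2) ^ 2 / (d1 * dd2 - d2 * dd1)) 0 (2 * L).

Definition Acal (L : R) (e1 e2 : R -> R) : R :=
  / 2 * RInt (fun s => e1 s * Derive e2 s - Derive e1 s * e2 s) 0 (2 * L).

(* gamma + phi N with N = gamma'^perp = (gy', -gx') *)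
Definition pert1 (x0 L : R) (phi : R -> R) (s : R) : R :=
  gx x0 L s + phi s * Derive (gy x0 L) s.
Definition pert2 (x0 L : R) (phi : R -> R) (s : R) : R :=
  gy x0 L s - phi s * Derive (gx x0 L) s.

Definition C2 (phi : R -> R) : Prop :=
  forall s, ex_derive phi s /\ ex_derive (Derive phi) s /\
            continuous (Derive (Derive phi)) s.

Definition W1_bc (L : R) (phi : R -> R) : Prop :=
  phi 0 = 0 /\ phi (2 * L) = 0 /\ Derive phi 0 = 0 /\ Derive phi (2 * L) = 0.

(* Main.v *)
Require Import Defs.
From Stdlib Require Import Reals Lra Psatz FunctionalExtensionality.
From Coquelicot Require Import Coquelicot.
Open Scope R_scope.

(** Parametrise gamma by its tangent angle z in [-pi, pi], s = L + k sin (c z) with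
    c = sqrt (x0 / (L + x0)) < 1/2, and put h = 1/H = c k cos (c z), f z = phi (s z).
    Up to a total derivative the increment of F - lambda A is bounded below by
      int f''^2 - (1 + c^2) f'^2 + c^2 f^2  -  O(eps) int (f^2 + f'^2 + f''^2).
    The first variation disappears because (h^2)'' = -2 c^2 in arc length and
    lambda = 2 (1 - c^2). Choosing alpha with f z0 = f (z0 + pi) = alpha, the quadratic
    form differs by a total derivative from
      c^2 (f'' + f)^2 + (1 - c^2) (f'^2 - (f - alpha)^2) + (1 - c^2) (f'' + f - alpha)^2,
    whose middle term has nonnegative integral by Wirtinger's inequality on two half
    circles, and int (f'' + f)^2 controls the H^2 norm of a clamped f by Gronwall. *)

(** * Continuity and integration *)

Lemma continuous_Rplus (f g : R -> R) x :
  continuous f x -> continuous g x -> continuous (fun t => f t + g t) x.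
Proof. intros; now apply (continuous_plus f g). Qed.

Lemma continuous_Rminus (f g : R -> R) x :
  continuous f x -> continuous g x -> continuous (fun t => f t - g t) x.
Proof. intros; now apply (continuous_minus f g). Qed.

Lemma continuous_Ropp (f : R -> R) x :
  continuous f x -> continuous (fun t => - f t) x.
Proof. intros; now apply (continuous_opp f). Qed.

Lemma continuous_Rmult (f g : R -> R) x :
  continuous f x -> continuous g x -> continuous (fun t => f t * g t) x.
Proof. intros; now apply (continuous_mult f g). Qed.

Lemma continuous_Rpow (f : R -> R) n x :
  continuous f x -> continuous (fun t => f t ^ n) x.
Proof.
  intros Hf; induction n as [|n IH]; simpl.
  - apply continuous_const.
  - now apply continuous_Rmult.
Qed.

Lemma continuous_Rinv_nz (f : R -> R) x :
  continuous f x -> f x <> 0 -> continuous (fun t => / f t) x.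
Proof. intros; now apply continuous_Rinv_comp. Qed.

Lemma continuous_sin_comp (f : R -> R) x :
  continuous f x -> continuous (fun t => sin (f t)) x.
Proof. intros; apply (continuous_comp f sin); auto. apply continuous_sin. Qed.

Lemma continuous_cos_comp (f : R -> R) x :
  continuous f x -> continuous (fun t => cos (f t)) x.
Proof. intros; apply (continuous_comp f cos); auto. apply continuous_cos. Qed.

Lemma continuous_exp_comp (f : R -> R) x :
  continuous f x -> continuous (fun t => exp (f t)) x.
Proof. intros; apply (continuous_comp f exp); auto. apply continuous_exp. Qed.

Ltac cont_leaf f :=
  match goal with
  | H : continuous f ?x |- continuous _ ?x => exact H
  | H : forall _, continuous f _ |- _ => apply H
  | H : forall _, _ -> continuous f _ |- _ => apply H; assumption
  | |- _ => idtac
  end.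

(** Recursion on the shape of the function. Its fallbacks are silent, so the goals it leaves are the
    nonvanishing of denominators and any leaf for which the context holds no continuity
    hypothesis. *)
Ltac cont :=
  lazymatch goal with
  | |- continuous (fun _ => ?c) _ => apply continuous_const
  | |- continuous (fun t => t) _ => apply continuous_id
  | |- continuous (fun t => @?f t + @?g t) _ => apply (continuous_Rplus f g); cont
  | |- continuous (fun t => @?f t - @?g t) _ => apply (continuous_Rminus f g); cont
  | |- continuous (fun t => - @?f t) _ => apply (continuous_Ropp f); cont
  | |- continuous (fun t => @?f t * @?g t) _ => apply (continuous_Rmult f g); cont
  | |- continuous (fun t => @?f t / @?g t) _ =>
      apply (continuous_Rmult f (fun t => / g t)); cont
  | |- continuous (fun t => (@?f t) ^ ?n) _ => apply (continuous_Rpow f n); cont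
  | |- continuous (fun t => sin (@?f t)) _ => apply (continuous_sin_comp f); cont
  | |- continuous (fun t => cos (@?f t)) _ => apply (continuous_cos_comp f); cont
  | |- continuous (fun t => exp (@?f t)) _ => apply (continuous_exp_comp f); cont
  | |- continuous (fun t => / @?f t) _ => apply (continuous_Rinv_nz f); [cont|]
  | |- continuous (fun t => ?f t) _ => cont_leaf f
  | |- continuous ?f _ => cont_leaf f
  | |- _ => idtac
  end.

Lemma ex_RInt_cont (g : R -> R) a b :
  a <= b -> (forall z, a <= z <= b -> continuous g z) -> ex_RInt g a b.
Proof.
  intros Hab Hg; apply (ex_RInt_continuous (V := R_CompleteNormedModule)).
  intros z; rewrite Rmin_left, Rmax_right by lra; apply Hg.
Qed.

(** Comparison up to a total derivative. Wirtinger's inequality, the coercivity of the clamped form,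
    the Gronwall estimate and the final gap are all reduced by it to a pointwise inequality, once a
    suitable [E] is found. *)
Lemma RInt_ge_boundary (g u E e : R -> R) a b :
  a <= b ->
  (forall z, a <= z <= b -> continuous g z) ->
  (forall z, a <= z <= b -> continuous u z) ->
  (forall z, a <= z <= b -> continuous e z) ->
  (forall z, a <= z <= b -> is_derive E z (e z)) ->
  (forall z, a < z < b -> e z + u z <= g z) ->
  E b - E a + RInt u a b <= RInt g a b.
Proof.
  intros Hab Hg Hu He HE Hle.
  assert (HI : is_RInt e a b (E b - E a)).
  { apply (is_RInt_derive (V := R_CompleteNormedModule));
      rewrite Rmin_left, Rmax_right by lra; auto. }
  rewrite <- (is_RInt_unique _ _ _ _ HI).
  assert (Hxu : ex_RInt u a b) by now apply ex_RInt_cont.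
  assert (Hxe : ex_RInt e a b) by now eexists; eauto.
  rewrite <- (RInt_plus (V := R_CompleteNormedModule)) by assumption.
  apply RInt_le; auto.
  - now apply (ex_RInt_plus (V := R_NormedModule)).
  - now apply ex_RInt_cont.
Qed.

Lemma RInt_nonneg_cont (g : R -> R) a b :
  a <= b -> (forall z, a <= z <= b -> continuous g z) ->
  (forall z, a < z < b -> 0 <= g z) -> 0 <= RInt g a b.
Proof. intros; apply RInt_ge_0; auto; now apply ex_RInt_cont. Qed.

Lemma RInt_Rplus (f g : R -> R) a b :
  a <= b ->
  (forall z, a <= z <= b -> continuous f z) ->
  (forall z, a <= z <= b -> continuous g z) ->
  RInt (fun t => f t + g t) a b = RInt f a b + RInt g a b.
Proof.
  intros; apply (RInt_plus (V := R_CompleteNormedModule)); now apply ex_RInt_cont.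
Qed.

Lemma RInt_Rminus (f g : R -> R) a b :
  a <= b ->
  (forall z, a <= z <= b -> continuous f z) ->
  (forall z, a <= z <= b -> continuous g z) ->
  RInt (fun t => f t - g t) a b = RInt f a b - RInt g a b.
Proof.
  intros; apply (RInt_minus (V := R_CompleteNormedModule)); now apply ex_RInt_cont.
Qed.

Lemma RInt_Rscal (f : R -> R) l a b :
  a <= b ->
  (forall z, a <= z <= b -> continuous f z) ->
  RInt (fun t => l * f t) a b = l * RInt f a b.
Proof.
  intros; apply (RInt_scal (V := R_CompleteNormedModule)); now apply ex_RInt_cont.
Qed.

Lemma is_derive_cont (f : R -> R) (x l : R) : is_derive f x l -> continuous f x.
Proof. intros H; apply (ex_derive_continuous f); now exists l. Qed.

(** * Wirtinger inequality and the clamped quadratic form *)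

Lemma is_derive_tan_lin mu ctr z :
  cos (mu * (z - ctr)) <> 0 ->
  is_derive (fun t => tan (mu * (t - ctr))) z (mu * (1 + tan (mu * (z - ctr)) ^ 2)).
Proof.
  intros Hc; unfold tan.
  auto_derive; [assumption|].
  change (z + - ctr) with (z - ctr).
  field; assumption.
Qed.

(* Riccati multiplier: u = - mu tan(mu (z - ctr)) solves u' + u^2 + mu^2 = 0. *)
Lemma wirtinger_segment (f f1 : R -> R) mu ctr a b :
  a <= b ->
  (forall z, is_derive f z (f1 z)) -> (forall z, continuous f1 z) ->
  (forall z, a <= z <= b -> cos (mu * (z - ctr)) <> 0) ->
  mu * tan (mu * (a - ctr)) * f a ^ 2 - mu * tan (mu * (b - ctr)) * f b ^ 2
    + mu ^ 2 * RInt (fun z => f z ^ 2) a b <= RInt (fun z => f1 z ^ 2) a b.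
Proof.
  intros Hab Df Cf1 Hc.
  assert (Cf : forall z, continuous f z) by (intros z; eapply is_derive_cont; apply Df).
  rewrite <- (RInt_Rscal (fun z => f z ^ 2)) by (auto; intros; cont).
  set (T := fun z => tan (mu * (z - ctr))).
  assert (DT : forall z, a <= z <= b -> is_derive T z (mu * (1 + T z ^ 2)))
    by (intros z Hz; apply is_derive_tan_lin; auto).
  assert (CT : forall z, a <= z <= b -> continuous T z)
    by (intros z Hz; eapply is_derive_cont; now apply DT).
  eapply Rle_trans; [|apply (RInt_ge_boundary (fun z => f1 z ^ 2) (fun z => mu ^ 2 * f z ^ 2)
    (fun z => - mu * (T z * f z ^ 2))
    (fun z => - mu * (mu * (1 + T z ^ 2) * f z ^ 2 + T z * (2 * f z * f1 z))))];
    [right; unfold T; ring|..];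
    auto; intros z Hz; try (specialize (CT z Hz); cont).
  - specialize (DT z Hz); specialize (Df z).
    evar (d : R). replace (- mu * _) with d; subst d.
    { apply is_derive_scal. apply (is_derive_mult T (fun t => f t ^ 2)).
      - apply DT.
      - apply is_derive_pow, Df.
      - intros; apply Rmult_comm. }
    unfold plus, mult; simpl; ring.
  (* This square is exactly the difference of the two sides. *)
  - pose proof (pow2_ge_0 (f1 z + mu * T z * f z)) as Hsq. nra.
Qed.

(** Replaces the limit [mu -> 1]. At [mu = 1] the tangent multiplier of [wirtinger_segment] would
    blow up at the ends of a half circle. *)
Lemma le_of_le_scaled (A B : R) :
  (forall mu, 0 < mu < 1 -> mu ^ 2 * B <= A) -> B <= A.
Proof.
  intros H. destruct (Rle_lt_dec B A) as [|Hlt]; auto. exfalso.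
  destruct (Rle_lt_dec B 0) as [HB|HB].
  - specialize (H (/2) ltac:(lra)). nra.
  (* With [d] equal to this quotient, passing from [B] to [(1 - d) ^ 2 * B] loses at most
     [2 * d * B <= (B - A) / 2], which leaves a value above [A]. *)
  - assert (Hm : 0 < (B - A) / (4 * B + 4 * Rabs A) < 1).
    { pose proof (Rle_abs A). pose proof (Rabs_pos A).
      pose proof (Rle_abs (- A)) as Hn; rewrite Rabs_Ropp in Hn.
      split; [apply Rdiv_lt_0_compat; lra|].
      apply Rmult_lt_reg_r with (4 * B + 4 * Rabs A); [lra|].
      unfold Rdiv; rewrite Rmult_assoc, Rinv_l by lra. lra. }
    set (d := (B - A) / (4 * B + 4 * Rabs A)) in *.
    assert (Hd : d * (4 * B + 4 * Rabs A) = B - A).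
    { unfold d; field. pose proof (Rabs_pos A); lra. }
    specialize (H (1 - d) ltac:(lra)).
    pose proof (Rabs_pos A). nra.
Qed.

Lemma cos_nz_half mu t : 0 < mu < 1 -> - (PI / 2) <= t <= PI / 2 -> cos (mu * t) <> 0.
Proof.
  intros Hmu Ht. pose proof PI_RGT_0.
  apply Rgt_not_eq, cos_gt_0; nra.
Qed.

(* By the intermediate value theorem f takes some value alpha at two antipodal points of
   the circle R / 2 pi; they cut it into two half circles on which f - alpha vanishes at both ends. *)
Lemma wirtinger_circle (f f1 : R -> R) :
  (forall z, is_derive f z (f1 z)) -> (forall z, continuous f1 z) ->
  f (- PI) = f PI ->
  exists alpha,
    RInt (fun z => (f z - alpha) ^ 2) (- PI) PI <= RInt (fun z => f1 z ^ 2) (- PI) PI.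
Proof.
  intros Df Cf1 Hper.
  pose proof PI_RGT_0 as HPI.
  assert (Cf : forall z, continuous f z) by (intros z; eapply is_derive_cont; apply Df).
  assert (Hz0 : exists z0, - PI <= z0 <= 0 /\ f (z0 + PI) = f z0).
  (* By periodicity the antipodal difference takes opposite values at [- PI] and [0]. *)
  { destruct (IVT_gen (fun z => f (z + PI) - f z) (- PI) 0 0) as [z0 [Hz Hfz]].
    - intros z. apply continuity_pt_filterlim.
      apply (continuous_Rminus (fun z => f (z + PI)) f); auto.
      apply (continuous_comp (fun z => z + PI) f); cont.
    - replace (- PI + PI) with 0 by ring. replace (0 + PI) with PI by ring.
      rewrite Hper. destruct (Rle_lt_dec (f 0 - f PI) 0).
      + rewrite Rmin_left, Rmax_right; lra.
      + rewrite Rmin_right, Rmax_left; lra.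
    - exists z0. rewrite Rmin_left, Rmax_right in Hz by lra. split; [exact Hz|lra]. }
  destruct Hz0 as [z0 [Hz0 Hval]].
  exists (f z0). set (alpha := f z0) in *.
  set (g := fun z => f z - alpha).
  assert (Dg : forall z, is_derive g z (f1 z)).
  { intros z. unfold g. evar_last.
    - apply (is_derive_minus f (fun _ => alpha)); [apply Df|apply is_derive_const].
    - unfold minus, plus, opp, zero; simpl; ring. }
  assert (Cg : forall z, continuous g z) by (intros z; eapply is_derive_cont; apply Dg).
  assert (g0 : g z0 = 0) by (unfold g, alpha; ring).
  assert (g1 : g (z0 + PI) = 0) by (unfold g; rewrite Hval; ring).
  assert (gper : g (- PI) = g PI) by (unfold g; rewrite Hper; ring).
  change (RInt (fun z => g z ^ 2) (- PI) PI <= RInt (fun z => f1 z ^ 2) (- PI) PI).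
  apply le_of_le_scaled; intros mu Hmu.
  assert (Hsplit : forall F : R -> R, (forall z, continuous F z) ->
    RInt F (- PI) PI = RInt F (- PI) z0 + RInt F z0 (z0 + PI) + RInt F (z0 + PI) PI).
  { intros F CF.
    rewrite <- (RInt_Chasles (V := R_CompleteNormedModule) F (- PI) (z0 + PI) PI)
      by (apply ex_RInt_cont; auto; lra).
    rewrite <- (RInt_Chasles (V := R_CompleteNormedModule) F (- PI) z0 (z0 + PI))
      by (apply ex_RInt_cont; auto; lra).
    reflexivity. }
  rewrite (Hsplit (fun z => g z ^ 2)) by (intros; cont).
  rewrite (Hsplit (fun z => f1 z ^ 2)) by (intros; cont).
  (* One half circle is [[z0, z0 + PI]]. The other is cut at the point where [- PI] and [PI] are
     glued; the centres used for its two pieces differ by [2 * PI], so the tangents at [- PI] and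
     [PI] agree and these boundary terms cancel. The other boundary terms carry a zero of [g]. *)
  pose proof (wirtinger_segment g f1 mu (z0 - PI / 2) (- PI) z0) as W1.
  pose proof (wirtinger_segment g f1 mu (z0 + PI / 2) z0 (z0 + PI)) as W2.
  pose proof (wirtinger_segment g f1 mu (z0 + 3 * PI / 2) (z0 + PI) PI) as W3.
  specialize (W1 ltac:(lra) Dg Cf1 ltac:(intros z Hz; apply cos_nz_half; lra)).
  specialize (W2 ltac:(lra) Dg Cf1 ltac:(intros z Hz; apply cos_nz_half; lra)).
  specialize (W3 ltac:(lra) Dg Cf1 ltac:(intros z Hz; apply cos_nz_half; lra)).
  rewrite g0 in W1, W2. rewrite g1 in W2, W3. rewrite gper in W1.
  replace (PI - (z0 + 3 * PI / 2)) with (- PI - (z0 - PI / 2)) in W3 by field.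
  lra.
Qed.

(** The decomposition into squares is an exact identity, with total derivative that of
    [(-2 * f + 2 * al * (1 - c ^ 2)) * f1]. Equal end values of [f] provide [al], and the vanishing
    of [f1] at both ends removes the boundary term whatever [al] is. *)
Lemma clamped_form_coercive (f f1 f2 : R -> R) c :
  0 < c < 1 ->
  (forall z, is_derive f z (f1 z)) -> (forall z, is_derive f1 z (f2 z)) ->
  (forall z, continuous f2 z) ->
  f (- PI) = 0 -> f PI = 0 -> f1 (- PI) = 0 -> f1 PI = 0 ->
  c ^ 2 * RInt (fun z => (f2 z + f z) ^ 2) (- PI) PI
    <= RInt (fun z => f2 z ^ 2 - (1 + c ^ 2) * f1 z ^ 2 + c ^ 2 * f z ^ 2) (- PI) PI.
Proof.
  intros Hc Df Df1 Cf2 B1 B2 B3 B4.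
  pose proof PI_RGT_0 as HPI.
  assert (Cf : forall z, continuous f z) by (intros z; eapply is_derive_cont; apply Df).
  assert (Cf1 : forall z, continuous f1 z) by (intros z; eapply is_derive_cont; apply Df1).
  destruct (wirtinger_circle f f1 Df Cf1) as [al Hal]; [lra|].
  set (psi2 := fun z => (f2 z + f z) ^ 2).
  set (u := fun z => c ^ 2 * psi2 z + (1 - c ^ 2) * (f1 z ^ 2 - (f z - al) ^ 2)).
  assert (Hu : RInt u (- PI) PI = c ^ 2 * RInt psi2 (- PI) PI
     + (1 - c ^ 2) * (RInt (fun z => f1 z ^ 2) (- PI) PI - RInt (fun z => (f z - al) ^ 2) (- PI) PI)).
  { unfold u.
    rewrite RInt_Rplus by (try lra; intros; unfold psi2; cont).
    rewrite (RInt_Rscal psi2) by (try lra; intros; unfold psi2; cont).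
    rewrite (RInt_Rscal (fun z => f1 z ^ 2 - (f z - al) ^ 2)) by (try lra; intros; cont).
    rewrite (RInt_Rminus (fun z => f1 z ^ 2) (fun z => (f z - al) ^ 2)) by (try lra; intros; cont).
    reflexivity. }
  assert (Hmain := RInt_ge_boundary
    (fun z => f2 z ^ 2 - (1 + c ^ 2) * f1 z ^ 2 + c ^ 2 * f z ^ 2) u
    (fun z => (-2 * f z + 2 * al * (1 - c ^ 2)) * f1 z)
    (fun z => (-2 * f1 z) * f1 z + (-2 * f z + 2 * al * (1 - c ^ 2)) * f2 z) (- PI) PI).
  assert (0 <= 1 - c ^ 2) by nra.
  assert (H' : 0 <= (1 - c ^ 2) * (RInt (fun z => f1 z ^ 2) (- PI) PI - RInt (fun z => (f z - al) ^ 2) (- PI) PI))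
    by (apply Rmult_le_pos; lra).
  simpl in Hmain. rewrite B3, B4, Hu in Hmain.
  match type of Hmain with ?A -> ?B -> ?C -> ?D -> ?E -> ?F -> _ =>
    assert (h1 : A) by lra; assert (h2 : B) by (intros; cont);
    assert (h3 : C) by (intros; unfold u, psi2; cont);
    assert (h4 : D) by (intros; cont);
    assert (h5 : E); [| assert (h6 : F); [| specialize (Hmain h1 h2 h3 h4 h5 h6) ] ] end.
  - intros z _. evar_last.
    + apply (is_derive_mult (fun z => -2 * f z + 2 * al * (1 - c ^ 2)) f1).
      * apply (is_derive_plus (fun z => -2 * f z) (fun _ => 2 * al * (1 - c ^ 2))).
        -- apply is_derive_scal, Df.
        -- apply is_derive_const.
      * apply Df1.
      * intros; apply Rmult_comm.
    + unfold plus, mult, zero; simpl; ring.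
  - intros z _. unfold u, psi2.
    assert (0 <= (1 - c ^ 2) * (f2 z + f z - al) ^ 2)
      by (apply Rmult_le_pos; [lra|apply pow2_ge_0]).
    nra.
  - fold psi2. simpl in *. lra.
Qed.

(** Gronwall for the oscillator energy [f ^ 2 + f1 ^ 2]: its derivative [2 * f1 * (f2 + f)] is at
    most [f1 ^ 2 + (f2 + f) ^ 2], hence the weight [exp (- t)]. Bounding the weight on the interval
    and undoing it at [z] cost a factor [exp PI] each. *)
Lemma clamped_pointwise (f f1 f2 : R -> R) :
  (forall z, is_derive f z (f1 z)) -> (forall z, is_derive f1 z (f2 z)) ->
  (forall z, continuous f2 z) ->
  f (- PI) = 0 -> f1 (- PI) = 0 ->
  forall z, - PI <= z <= PI ->
  f z ^ 2 + f1 z ^ 2 <= exp (2 * PI) * RInt (fun t => (f2 t + f t) ^ 2) (- PI) PI.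
Proof.
  intros Df Df1 Cf2 B1 B3 z Hz.
  pose proof PI_RGT_0 as HPI.
  assert (Cf : forall z, continuous f z) by (intros t; eapply is_derive_cont; apply Df).
  assert (Cf1 : forall z, continuous f1 z) by (intros t; eapply is_derive_cont; apply Df1).
  set (psi2 := fun t => (f2 t + f t) ^ 2).
  assert (Cpsi : forall z, continuous psi2 z) by (intros; unfold psi2; cont).
  assert (H := RInt_ge_boundary (fun t => exp PI * psi2 t) (fun _ => 0)
    (fun t => exp (- t) * (f t ^ 2 + f1 t ^ 2))
    (fun t => - exp (- t) * (f t ^ 2 + f1 t ^ 2)
              + exp (- t) * (2 * f t * f1 t + 2 * f1 t * f2 t)) (- PI) z).
  match type of H with ?A -> ?B -> ?C -> ?D -> ?E -> ?F -> _ =>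
    assert (h1 : A) by lra; assert (h2 : B) by (intros; cont);
    assert (h3 : C) by (intros; cont);
    assert (h4 : D) by (intros; cont);
    assert (h5 : E); [| assert (h6 : F); [| specialize (H h1 h2 h3 h4 h5 h6) ] ] end.
  - intros t _. evar_last.
    + apply (is_derive_mult (fun t => exp (- t)) (fun t => f t ^ 2 + f1 t ^ 2)).
      * apply (is_derive_comp exp (fun t => - t) t (exp (- t)) (-1)).
        -- apply is_derive_exp.
        -- auto_derive; auto; ring.
      * apply (is_derive_plus (fun t => f t ^ 2) (fun t => f1 t ^ 2)).
        -- apply is_derive_pow, Df.
        -- apply is_derive_pow, Df1.
      * intros; apply Rmult_comm.
    + unfold plus, mult, scal; simpl; unfold mult; simpl; ring.
  - intros t Ht. rewrite Rplus_0_r.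
    assert (Hexp : exp (- t) <= exp PI)
      by (destruct (Req_dec t (- PI)) as [->|]; [rewrite Ropp_involutive; lra|];
          left; apply exp_increasing; lra).
    assert (0 < exp (- t)) by apply exp_pos.
    assert (0 <= psi2 t) by apply pow2_ge_0.
    apply Rle_trans with (exp (- t) * psi2 t); [|now apply Rmult_le_compat_r].
    assert (Hq : - (f t ^ 2 + f1 t ^ 2) + (2 * f t * f1 t + 2 * f1 t * f2 t) <= psi2 t).
    { unfold psi2. pose proof (pow2_ge_0 (f2 t + f t - f1 t)).
      pose proof (pow2_ge_0 (f t)). nra. }
    apply (Rmult_le_compat_l (exp (- t))) in Hq; lra.
  - cbv beta in H. rewrite B1, B3 in H.
    rewrite RInt_const, RInt_Rscal in H by (auto; lra).
    assert (Hmono : RInt psi2 (- PI) z <= RInt psi2 (- PI) PI).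
    { rewrite <- (RInt_Chasles (V := R_CompleteNormedModule) psi2 (- PI) z PI)
        by (apply ex_RInt_cont; auto; lra).
      assert (0 <= RInt psi2 z PI)
        by (apply RInt_nonneg_cont; auto; [lra|intros; apply pow2_ge_0]).
      unfold plus; simpl; lra. }
    assert (H0 : exp (- z) * (f z ^ 2 + f1 z ^ 2) <= exp PI * RInt psi2 (- PI) PI).
    { unfold scal in H; simpl in H; unfold mult in H; simpl in H.
      pose proof (exp_pos PI). simpl. nra. }
    apply (Rmult_le_compat_l (exp z)) in H0; [|left; apply exp_pos].
    rewrite <- Rmult_assoc, <- exp_plus, Rplus_opp_r, exp_0, Rmult_1_l in H0.
    rewrite <- Rmult_assoc, <- exp_plus in H0.
    eapply Rle_trans; [exact H0|].
    apply Rmult_le_compat_r.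
    + apply RInt_nonneg_cont; auto; [lra|intros; apply pow2_ge_0].
    + destruct (Req_dec z PI) as [->|]; [right; f_equal; ring|].
      left; apply exp_increasing; lra.
Qed.

(** Since [f2 ^ 2 <= 2 * (f2 + f) ^ 2 + 2 * f ^ 2], the integrand is at most [2 * (f2 + f) ^ 2] plus
    three times the pointwise bound; the latter is integrated over an interval of length
    [2 * PI]. *)
Lemma clamped_norm_bound (f f1 f2 : R -> R) :
  (forall z, is_derive f z (f1 z)) -> (forall z, is_derive f1 z (f2 z)) ->
  (forall z, continuous f2 z) ->
  f (- PI) = 0 -> f1 (- PI) = 0 ->
  RInt (fun z => f z ^ 2 + f1 z ^ 2 + f2 z ^ 2) (- PI) PI
    <= (2 + 6 * PI * exp (2 * PI)) * RInt (fun t => (f2 t + f t) ^ 2) (- PI) PI.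
Proof.
  intros Df Df1 Cf2 B1 B3.
  pose proof PI_RGT_0 as HPI.
  assert (Cf : forall z, continuous f z) by (intros t; eapply is_derive_cont; apply Df).
  assert (Cf1 : forall z, continuous f1 z) by (intros t; eapply is_derive_cont; apply Df1).
  pose proof (clamped_pointwise f f1 f2 Df Df1 Cf2 B1 B3) as Hpt.
  set (psi2 := fun t => (f2 t + f t) ^ 2) in *.
  assert (Cpsi : forall z, continuous psi2 z) by (intros; unfold psi2; cont).
  set (I := RInt psi2 (- PI) PI) in *.
  replace ((2 + 6 * PI * exp (2 * PI)) * I)
    with (RInt (fun t => 2 * psi2 t + 3 * (exp (2 * PI) * I)) (- PI) PI).
  - apply RInt_le; try lra.
    + apply ex_RInt_cont; [lra|]; intros; cont.
    + apply ex_RInt_cont; [lra|]; intros; cont.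
    + intros z Hz. specialize (Hpt z ltac:(lra)). unfold psi2.
      pose proof (pow2_ge_0 (f2 z + 2 * f z)). pose proof (pow2_ge_0 (f1 z)). nra.
  - rewrite (RInt_Rplus (fun t => 2 * psi2 t) (fun _ => 3 * (exp (2 * PI) * I)))
      by (try lra; intros; cont).
    rewrite RInt_Rscal by (try lra; intros; cont).
    rewrite RInt_const. fold I. unfold scal; simpl; unfold mult; simpl. ring.
Qed.

(** * Pointwise lower bound for the integrand of F, and the gap in the angle variable *)

Lemma Rabs_mult_le a b A B : Rabs a <= A -> Rabs b <= B -> Rabs (a * b) <= A * B.
Proof.
  intros; rewrite Rabs_mult; apply Rmult_le_compat; auto using Rabs_pos.
Qed.

Lemma scaled_square_bound a u d : Rabs a <= d -> - d * u ^ 2 <= a * u ^ 2 <= d * u ^ 2.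
Proof. intros H%Rabs_le_between. pose proof (pow2_ge_0 u). nra. Qed.

(** Dimensionless variables: [q = phi / h], [r = phi'], [w = h * phi''] and [b = h'] in arc length.
    The expression is [h] times the determinant of the first two derivatives of gamma + phi N, so
    the perturbed curve keeps positive curvature. The smallness condition gives both [d < 1 / 4] and
    [d * B < 1 / 3]. *)
Lemma speed_quotient_denominator_pos (q r w b d B : R) :
  Rabs q <= d -> Rabs r <= d -> Rabs w <= d -> Rabs b <= B ->
  d * (4 + 3 * B) < 1 ->
  0 < (1 + q) ^ 2 - (1 + q) * w + 2 * r ^ 2 - q * r * b.
Proof.
  intros Hq Hr Hw Hb Hd.
  assert (0 <= B) by (eapply Rle_trans; [apply Rabs_pos|eassumption]).
  assert (0 <= d) by (eapply Rle_trans; [apply Rabs_pos|apply Hq]).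
  assert (HdB : 0 <= d * B) by now apply Rmult_le_pos.
  assert (Hd1 : d <= / 4) by lra.
  assert (Hqrb : Rabs (q * r * b) <= d * d * B) by (repeat apply Rabs_mult_le; auto).
  apply Rabs_le_between in Hqrb. apply Rabs_le_between in Hq. apply Rabs_le_between in Hw.
  assert ((1 + q) * (1 + q - w) >= (1 - d) * (1 - 2 * d)) by nra.
  assert (d * d * B <= d * B / 4) by nra.
  nra.
Qed.

(* The numerator is handled by n^2 / D >= 2 t n - t^2 D with t = 1 + w, which is
   optimal up to second order. *)
Lemma speed_quotient_lower (q r w b d B : R) :
  Rabs q <= d -> Rabs r <= d -> Rabs w <= d -> Rabs b <= B ->
  d * (4 + 3 * B) < 1 ->
  1 + 2 * q + w + q ^ 2 + q * w + q * r * b + w ^ 2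
    - (4 + 3 * B) * d * (q ^ 2 + r ^ 2 + w ^ 2)
  <= ((1 + q) ^ 2 + r ^ 2) ^ 2 / ((1 + q) ^ 2 - (1 + q) * w + 2 * r ^ 2 - q * r * b).
Proof.
  intros Hq Hr Hw Hb Hd.
  pose proof (speed_quotient_denominator_pos q r w b d B Hq Hr Hw Hb Hd) as HD.
  set (D := (1 + q) ^ 2 - (1 + q) * w + 2 * r ^ 2 - q * r * b) in *.
  assert (H0B : 0 <= B) by (eapply Rle_trans; [apply Rabs_pos|eassumption]).
  assert (H0d : 0 <= d) by (eapply Rle_trans; [apply Rabs_pos|apply Hq]).
  assert (HdB : 0 <= d * B) by now apply Rmult_le_pos.
  assert (Hd1 : d <= / 4) by lra.
  set (n := (1 + q) ^ 2 + r ^ 2).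
  apply Rle_trans with (2 * (1 + w) * n - (1 + w) ^ 2 * D).
  (* Exact expansion: the second order Taylor polynomial plus four terms of order three or more,
     each a small factor times a square or times [q * r]. The worst coefficients, [4 * d] on [r ^ 2]
     and [3 * B * d] from [m], add up to [(4 + 3 * B) * d]. *)
  - set (m := b * w * (2 + w)).
    replace (2 * (1 + w) * n - (1 + w) ^ 2 * D)
      with (1 + 2 * q + w + q ^ 2 + q * w + q * r * b + w ^ 2
            + (w * (1 + q)) * w ^ 2 + (- w * w) * q ^ 2 + (-2 * (w * (1 + w))) * r ^ 2
            + m * (q * r)) by (unfold n, D, m; ring).
    assert (H1q : Rabs (1 + q) <= 2)
      by (apply Rabs_le_between; apply Rabs_le_between in Hq; lra).
    assert (H1w : Rabs (1 + w) <= 2)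
      by (apply Rabs_le_between; apply Rabs_le_between in Hw; lra).
    assert (H2w : Rabs (2 + w) <= 3)
      by (apply Rabs_le_between; apply Rabs_le_between in Hw; lra).
    assert (S1 := scaled_square_bound (w * (1 + q)) w (d * 2) ltac:(now apply Rabs_mult_le)).
    assert (S2 := scaled_square_bound (- w * w) q (d * 1)).
    assert (S3 := scaled_square_bound (-2 * (w * (1 + w))) r (2 * (d * 2))).
    specialize (S2 ltac:(apply Rabs_mult_le; [rewrite Rabs_Ropp; auto|lra])).
    specialize (S3 ltac:(apply Rabs_mult_le;
      [rewrite Rabs_left; lra | now apply Rabs_mult_le])).
    assert (Hm : Rabs m <= B * d * 3) by (unfold m; repeat apply Rabs_mult_le; auto).
    apply Rabs_le_between in Hm.
    assert (Hmqr : - (B * d * 3) * (q ^ 2 + r ^ 2) <= m * (q * r)).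
    { pose proof (pow2_ge_0 (q - r)). pose proof (pow2_ge_0 (q + r)).
      assert (- (q ^ 2 + r ^ 2) <= 2 * (q * r) <= q ^ 2 + r ^ 2) by nra.
      assert (0 <= q ^ 2 + r ^ 2) by nra.
      assert (0 <= B * d * 3) by nra.
      destruct (Rle_lt_dec 0 (q * r)); nra. }
    assert (0 <= B * d * w ^ 2)
      by (apply Rmult_le_pos; [now apply Rmult_le_pos|apply pow2_ge_0]).
    pose proof (pow2_ge_0 q). pose proof (pow2_ge_0 r). pose proof (pow2_ge_0 w).
    nra.
  - apply Rmult_le_reg_r with D; [assumption|].
    fold n. replace (n ^ 2 / D * D) with (n ^ 2) by (field; lra).
    pose proof (pow2_ge_0 (n - (1 + w) * D)). nra.
Qed.

(* Integrand of F at gamma + phi N, in terms of h = 1/H, b = h', u = phi, u1 = phi',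
   u2 = phi''. *)
Definition Fdens (h b u u1 u2 : R) : R :=
  h * (((1 + u / h) ^ 2 + u1 ^ 2) ^ 2
       / ((1 + u / h) ^ 2 - (1 + u / h) * (h * u2) + 2 * u1 ^ 2 - u / h * u1 * b)).

(* Twice the integrand of A at gamma + phi N, where gamma = (x, y) has unit tangent
   -(cos t, sin t) and N = (- sin t, cos t). *)
Definition Adens (x y t h u u1 : R) : R :=
  (x - u * sin t) * (- (1 + u / h) * sin t + u1 * cos t)
  - (- (1 + u / h) * cos t - u1 * sin t) * (y + u * cos t).

(** As ds = [h] dz, [r] and [v] are the arc length derivatives of phi read at angle [z]. Pointwise,
    the perturbed integrand exceeds the unperturbed one by the clamped form minus a cubic error, up
    to the derivative of a function vanishing at both ends. The smallness of [d] lets the coercivity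
    constant [c ^ 2] absorb the error. *)
Lemma gap_in_angle (c k d B : R) (X Y f r v : R -> R) :
  let h := fun z => c * k * cos (c * z) in
  let b := fun z => - c * (sin (c * z) / cos (c * z)) in
  0 < c < 1 -> 0 < k ->
  (forall z, - PI <= z <= PI -> 0 < cos (c * z)) ->
  (forall z, - PI <= z <= PI -> is_derive X z (- cos z * h z)) ->
  (forall z, - PI <= z <= PI -> is_derive Y z (- sin z * h z)) ->
  (forall z, is_derive f z (h z * r z)) ->
  (forall z, is_derive r z (h z * v z)) ->
  (forall z, continuous v z) ->
  f (- PI) = 0 -> f PI = 0 -> r (- PI) = 0 -> r PI = 0 ->
  (exists z, - PI <= z <= PI /\ f z <> 0) ->
  (forall z, - PI <= z <= PI -> Rabs (f z / h z) <= d /\ Rabs (r z) <= d /\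
     Rabs (h z * v z) <= d /\ Rabs (b z) <= B) ->
  d * (4 + 3 * B) * (2 + 2 * B ^ 2) * (2 + 6 * PI * exp (2 * PI)) < c ^ 2 ->
  RInt (fun z => h z * (h z - (1 - c ^ 2) * Adens (X z) (Y z) z (h z) 0 0)) (- PI) PI
  < RInt (fun z => h z * (Fdens (h z) (b z) (f z) (r z) (v z)
                    - (1 - c ^ 2) * Adens (X z) (Y z) z (h z) (f z) (r z))) (- PI) PI.
Proof.
  intros h b Hc Hk Hcos DX DY Df Dr Cv f0 f1 r0 r1 [z1 [Hz1 Hfz1]] Hbd Hd.
  pose proof PI_RGT_0 as HPI.
  assert (Cf : forall z, continuous f z) by (intros t; eapply is_derive_cont; apply Df).
  assert (Cr : forall z, continuous r z) by (intros t; eapply is_derive_cont; apply Dr).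
  assert (CX : forall z, - PI <= z <= PI -> continuous X z)
    by (intros t Ht; eapply is_derive_cont; now apply DX).
  assert (CY : forall z, - PI <= z <= PI -> continuous Y z)
    by (intros t Ht; eapply is_derive_cont; now apply DY).
  assert (Ch : forall z, continuous h z) by (intros; unfold h; cont).
  assert (Hh : forall z, - PI <= z <= PI -> 0 < h z).
  { intros z Hz. specialize (Hcos z Hz). unfold h. repeat apply Rmult_lt_0_compat; lra. }
  assert (HB : 0 <= B).
  { destruct (Hbd 0 ltac:(lra)) as (_ & _ & _ & H).
    eapply Rle_trans; [apply Rabs_pos|apply H]. }
  assert (H0d : 0 <= d).
  { destruct (Hbd 0 ltac:(lra)) as (_ & H & _ & _).
    eapply Rle_trans; [apply Rabs_pos|apply H]. }
  set (N := 2 + 6 * PI * exp (2 * PI)) in *.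
  assert (HN : 1 <= N).
  { unfold N. pose proof (exp_pos (2 * PI)).
    assert (0 < PI * exp (2 * PI)) by now apply Rmult_lt_0_compat. lra. }
  set (kap := d * (4 + 3 * B) * (2 + 2 * B ^ 2)) in *.
  assert (HdB : 0 <= d * (4 + 3 * B)) by (apply Rmult_le_pos; lra).
  assert (Hkap : d * (4 + 3 * B) <= kap).
  { unfold kap. pose proof (pow2_ge_0 B). nra. }
  assert (Hsmall : d * (4 + 3 * B) < 1) by nra.
  (* First and second derivatives of [f] in the angle. *)
  set (g1 := fun z => h z * r z).
  set (g2 := fun z => - c ^ 2 * k * sin (c * z) * r z + h z * (h z * v z)).
  assert (Dg1 : forall z, is_derive g1 z (g2 z)).
  { intros z. unfold g1. evar_last.
    - apply (is_derive_mult h r); [|apply Dr|intros; apply Rmult_comm].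
      unfold h. auto_derive; [exact I|]. reflexivity.
    - unfold g2, plus, mult; simpl; ring. }
  assert (Cg1 : forall z, continuous g1 z) by (intros; unfold g1; cont).
  assert (Cg2 : forall z, continuous g2 z) by (intros; unfold g2; cont).
  assert (g10 : g1 (- PI) = 0) by (unfold g1; rewrite r0; ring).
  assert (g11 : g1 PI = 0) by (unfold g1; rewrite r1; ring).
  pose proof (clamped_form_coercive f g1 g2 c Hc Df Dg1 Cg2 f0 f1 g10 g11) as Hcoer.
  pose proof (clamped_norm_bound f g1 g2 Df Dg1 Cg2 f0 g10) as Hnorm.
  fold N in Hnorm.
  pose proof (clamped_pointwise f g1 g2 Df Dg1 Cg2 f0 g10 z1 Hz1) as Hpt.
  set (I := RInt (fun z => (g2 z + f z) ^ 2) (- PI) PI) in *.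
  (* Source of the strict inequality: [I] controls [f] pointwise, and [f z1] is nonzero. *)
  assert (HI : 0 < I).
  { assert (0 < f z1 ^ 2) by (apply pow2_gt_0; auto).
    pose proof (pow2_ge_0 (g1 z1)). pose proof (exp_pos (2 * PI)).
    destruct (Rle_lt_dec I 0); nra. }
  set (Qf := fun z => g2 z ^ 2 - (1 + c ^ 2) * g1 z ^ 2 + c ^ 2 * f z ^ 2) in *.
  set (Nf := fun z => f z ^ 2 + g1 z ^ 2 + g2 z ^ 2) in *.
  set (G0 := fun z => h z * (h z - (1 - c ^ 2) * Adens (X z) (Y z) z (h z) 0 0)).
  set (G1 := fun z => h z * (Fdens (h z) (b z) (f z) (r z) (v z)
                    - (1 - c ^ 2) * Adens (X z) (Y z) z (h z) (f z) (r z))).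
  assert (CQ : forall z, continuous Qf z) by (intros; unfold Qf; cont).
  assert (CN : forall z, continuous Nf z) by (intros; unfold Nf; cont).
  assert (CG0 : forall z, - PI <= z <= PI -> continuous G0 z).
  { intros z Hz. unfold G0, Adens. cont; apply Rgt_not_eq, Hh, Hz. }
  assert (CG1 : forall z, - PI <= z <= PI -> continuous G1 z).
  { intros z Hz. pose proof (Hh z Hz). pose proof (Hcos z Hz).
    destruct (Hbd z Hz) as (b1 & b2 & b3 & b4).
    pose proof (speed_quotient_denominator_pos _ _ _ _ _ _ b1 b2 b3 b4 Hsmall).
    unfold G1, Fdens, Adens, b. cont; try lra. fold (b z). lra. }
  (* Integrations by parts, using [h'' = - c ^ 2 * h], with primes for angle derivatives. The first
     two terms turn [h ^ 3 * v] into [- 2 * c ^ 2 * h * f]; the third turns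
     [f * (h ^ 2 * v + h' * r)] into [- g1 ^ 2]; the fourth turns [(h ^ 2 * v) ^ 2] into
     [g2 ^ 2 - c ^ 2 * g1 ^ 2]. The last reduces the linear part of the area to [2 * h * f], so the
     linear terms cancel: [2 - 2 * c ^ 2 = 2 * (1 - c ^ 2)]. *)
  set (E := fun z => h z ^ 2 * r z + 2 * c ^ 2 * k * sin (c * z) * f z + f z * (h z * r z)
     + c ^ 2 * k * sin (c * z) * h z * r z ^ 2
     - (1 - c ^ 2) * (f z * (X z * cos z + Y z * sin z))).
  set (e := fun z => let h' := - c ^ 2 * k * sin (c * z) in
     2 * h z * h' * r z + h z ^ 2 * (h z * v z)
     + 2 * c ^ 2 * k * (c * cos (c * z) * f z + sin (c * z) * (h z * r z))
     + h z * r z * (h z * r z) + f z * (h' * r z + h z * (h z * v z))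
     + c ^ 2 * k * (c * cos (c * z) * h z * r z ^ 2 + sin (c * z) * h' * r z ^ 2
                    + sin (c * z) * h z * (2 * r z * (h z * v z)))
     - (1 - c ^ 2) * (h z * r z * (X z * cos z + Y z * sin z)
                      + f z * (- X z * sin z + Y z * cos z - h z))).
  assert (Hmain := RInt_ge_boundary G1 (fun z => G0 z + (Qf z - kap * Nf z)) E e (- PI) PI).
  match type of Hmain with ?P1 -> ?P2 -> ?P3 -> ?P4 -> ?P5 -> ?P6 -> _ =>
    assert (h1 : P1) by lra; assert (h2 : P2) by exact CG1;
    assert (h3 : P3) by (intros; cont);
    assert (h4 : P4) by (intros; unfold e; cont);
    assert (h5 : P5); [| assert (h6 : P6); [| specialize (Hmain h1 h2 h3 h4 h5 h6) ] ] end.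
  - intros z Hz. unfold E, e.
    assert (Dh : is_derive h z (- c ^ 2 * k * sin (c * z)))
      by (unfold h; auto_derive; [exact Logic.I|ring]).
    specialize (DX z Hz). specialize (DY z Hz). specialize (Df z). specialize (Dr z).
    clearbody h.
    auto_derive.
    + repeat split; eexists; eassumption.
    + replace (Derive (fun t => h t) z) with (- c ^ 2 * k * sin (c * z))
        by (symmetry; now apply is_derive_unique).
      replace (Derive (fun t => f t) z) with (h z * r z)
        by (symmetry; now apply is_derive_unique).
      replace (Derive (fun t => r t) z) with (h z * v z)
        by (symmetry; now apply is_derive_unique).
      replace (Derive (fun t => X t) z) with (- cos z * h z)
        by (symmetry; now apply is_derive_unique).
      replace (Derive (fun t => Y t) z) with (- sin z * h z)
        by (symmetry; now apply is_derive_unique).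
      pose proof (sin2_cos2 z) as Hsc. unfold Rsqr in Hsc.
      assert (Hc2 : cos z * cos z = 1 - sin z * sin z) by lra.
      ring [Hc2].
  - intros z Hz. assert (Hz' : - PI <= z <= PI) by lra.
    specialize (Hcos z Hz'). specialize (Hh z Hz').
    destruct (Hbd z Hz') as (b1 & b2 & b3 & b4).
    pose proof (speed_quotient_lower _ _ _ _ _ _ b1 b2 b3 b4 Hsmall) as Hlow.
    unfold G0, G1, Fdens, Adens.
    match type of Hlow with ?l <= ?q => set (quo := q) in *; set (low := l) in * end.
    assert (Hquo : h z * (h z * low) <= h z * (h z * quo))
      by (repeat apply Rmult_le_compat_l; lra).
    enough (e z + (G0 z + (Qf z - kap * Nf z))
            <= h z * (h z * low - (1 - c ^ 2) * Adens (X z) (Y z) z (h z) (f z) (r z)))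
      by (unfold G0, Adens in *; lra).
    set (rem := (4 + 3 * B) * d * (f z ^ 2 + g1 z ^ 2 + (h z ^ 2 * v z) ^ 2)).
    assert (Hrem : rem <= kap * Nf z).
    { unfold rem, kap, Nf.
      (* The error involves [h ^ 2 * v], which differs from [g2] by [b * g1]; squaring the sum
         produces the factor [2 + 2 * B ^ 2] of [kap]. *)
      assert (Hv : h z ^ 2 * v z = g2 z + - b z * g1 z)
        by (unfold g2, g1, b; unfold h; field; lra).
      rewrite Hv.
      assert (Hb2 : b z ^ 2 <= B ^ 2)
        by (rewrite <- (pow2_abs (b z)); apply pow_incr; split; [apply Rabs_pos|assumption]).
      rewrite !(Rmult_comm (4 + 3 * B) d), !Rmult_assoc.
      rewrite <- !Rmult_assoc, (Rmult_assoc (d * (4 + 3 * B))).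
      apply Rmult_le_compat_l; [assumption|].
      pose proof (pow2_ge_0 (g2 z + b z * g1 z)).
      pose proof (pow2_ge_0 (f z)). pose proof (pow2_ge_0 (g1 z)).
      pose proof (pow2_ge_0 (g2 z)). pose proof (pow2_ge_0 B).
      assert (b z ^ 2 * g1 z ^ 2 <= B ^ 2 * g1 z ^ 2) by now apply Rmult_le_compat_r.
      nra. }
    (* All inequalities are spent: an algebraic identity remains, checked after expressing
       [cos (c * z)] through [h]. *)
    enough (h z * (h z * low - (1 - c ^ 2) * Adens (X z) (Y z) z (h z) (f z) (r z))
            = e z + G0 z + Qf z - rem) by lra.
    unfold low, e, G0, Qf, rem, Adens, g1, g2, b.
    pose proof (sin2_cos2 z) as Hsc. unfold Rsqr in Hsc.
    assert (Hc2 : sin z * sin z = 1 - cos z * cos z) by lra.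
    assert (Hckz : cos (c * z) = h z / (c * k)) by (unfold h; field; lra).
    rewrite Hckz. clearbody h.
    field [Hc2]; lra.
  - unfold E in Hmain. rewrite f0, f1, r0, r1 in Hmain.
    rewrite RInt_Rplus in Hmain by (try lra; auto; intros; cont).
    rewrite RInt_Rminus in Hmain by (try lra; auto; intros; cont).
    rewrite RInt_Rscal in Hmain by (try lra; auto; intros; cont).
    assert (kap * RInt Nf (- PI) PI <= kap * (N * I))
      by (apply Rmult_le_compat_l; [lra|exact Hnorm]).
    assert (0 < (c ^ 2 - kap * N) * I) by (apply Rmult_lt_0_compat; lra).
    nra.
Qed.

(** * Geometry of gamma + phi N *)

Definition cpar (x0 L : R) : R := sqrt (x0 / (L + x0)).

(** Radius of curvature 1/H of gamma at arc length [s]. *)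
Definition hpar (x0 L s : R) : R := cpar x0 L * kpar x0 L * cos (apar x0 L s).

(** Tangent angle: gamma has unit tangent [- (cos theta, sin theta)]. *)
Definition theta (x0 L s : R) : R := apar x0 L s / cpar x0 L.

(** The condition [3 * x0 < L] says [x0 / (L + x0) < 1 / 4]. The bound by one half keeps sigma below
    pi / 2, where the cosine is positive and arcsin inverts sin. *)
Lemma cpar_bounds x0 L : 0 < x0 -> 3 * x0 < L -> 0 < cpar x0 L < / 2.
Proof.
  intros H0 HL. unfold cpar. split.
  - apply sqrt_lt_R0. apply Rdiv_lt_0_compat; lra.
  - rewrite <- (sqrt_Rsqr (/ 2)) by lra. apply sqrt_lt_1_alt. split.
    + left; apply Rdiv_lt_0_compat; lra.
    + unfold Rsqr. apply Rmult_lt_reg_r with (L + x0); [lra|].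
      unfold Rdiv; rewrite Rmult_assoc, Rinv_l by lra. lra.
Qed.

Lemma sigma_bounds x0 L : 0 < x0 -> 3 * x0 < L -> 0 < Defs.sigma x0 L < PI / 2.
Proof.
  intros H0 HL. pose proof (cpar_bounds x0 L H0 HL) as Hc. pose proof PI_RGT_0.
  change (Defs.sigma x0 L) with (PI * cpar x0 L). nra.
Qed.

Lemma sin_sigma_bounds x0 L : 0 < x0 -> 3 * x0 < L -> 0 < sin (Defs.sigma x0 L) < 1.
Proof.
  intros H0 HL. pose proof (sigma_bounds x0 L H0 HL) as Hs. pose proof PI_RGT_0.
  split; [apply sin_gt_0; lra|].
  rewrite <- sin_PI2. apply sin_increasing_1; lra.
Qed.

(** The strict inequality puts [[0, 2 * L]] inside the open set [Rabs (s - L) < k] on which arcsin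
    is differentiable, so two-sided derivatives exist at the end points too. *)
Lemma kpar_gt x0 L : 0 < x0 -> 3 * x0 < L -> L < kpar x0 L.
Proof.
  intros H0 HL. pose proof (sin_sigma_bounds x0 L H0 HL) as Hs. unfold kpar.
  apply Rmult_lt_reg_r with (sin (Defs.sigma x0 L)); [lra|].
  unfold Rdiv; rewrite Rmult_assoc, Rinv_l by lra. nra.
Qed.

Lemma kpar_sin x0 L : 0 < x0 -> 3 * x0 < L -> kpar x0 L * sin (Defs.sigma x0 L) = L.
Proof.
  intros H0 HL. pose proof (sin_sigma_bounds x0 L H0 HL). unfold kpar. field; lra.
Qed.

Lemma locally_chart L k s : Rabs (s - L) < k -> locally s (fun t => Rabs (t - L) < k).
Proof.
  intros Hs. assert (He : 0 < k - Rabs (s - L)) by lra.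
  exists (mkposreal _ He). intros t Ht.
  unfold ball in Ht; simpl in Ht; unfold AbsRing_ball, abs, minus, plus, opp in Ht; simpl in Ht.
  replace (t - L) with ((t + - s) + (s - L)) by ring.
  eapply Rle_lt_trans; [apply Rabs_triang|lra].
Qed.

Lemma chart_ratio L k s : 0 < k -> Rabs (s - L) < k -> -1 < (s - L) / k < 1.
Proof.
  intros Hk Hs. apply Rabs_lt_between in Hs.
  split; apply Rmult_lt_reg_r with k; auto;
    unfold Rdiv; rewrite Rmult_assoc, Rinv_l by lra; lra.
Qed.

Lemma cos_apar_pos x0 L s :
  0 < x0 -> 3 * x0 < L -> Rabs (s - L) < kpar x0 L -> 0 < cos (apar x0 L s).
Proof.
  intros H0 HL Hs. pose proof (kpar_gt x0 L H0 HL).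
  pose proof (chart_ratio L (kpar x0 L) s ltac:(lra) Hs) as Hu.
  unfold apar. pose proof (asin_bound_lt _ Hu). apply cos_gt_0; lra.
Qed.

Lemma is_derive_apar x0 L s :
  0 < x0 -> 3 * x0 < L -> Rabs (s - L) < kpar x0 L ->
  is_derive (apar x0 L) s (/ (kpar x0 L * cos (apar x0 L s))).
Proof.
  intros H0 HL Hs. pose proof (kpar_gt x0 L H0 HL).
  pose proof (chart_ratio L (kpar x0 L) s ltac:(lra) Hs) as Hu.
  pose proof (cos_apar_pos x0 L s H0 HL Hs) as Hc.
  evar_last.
  - apply (is_derive_comp asin (fun s => (s - L) / kpar x0 L)).
    + apply is_derive_Reals, (derive_pt_eq_1 _ _ _ _ (derive_pt_asin _ Hu)).
    + auto_derive; [lra|]. reflexivity.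
  - unfold apar in *. rewrite cos_asin in * by lra.
    set (w := sqrt _) in *. unfold scal; simpl; unfold mult; simpl. field. lra.
Qed.

Lemma hpar_pos x0 L s :
  0 < x0 -> 3 * x0 < L -> Rabs (s - L) < kpar x0 L -> 0 < hpar x0 L s.
Proof.
  intros H0 HL Hs. pose proof (kpar_gt x0 L H0 HL).
  pose proof (cos_apar_pos x0 L s H0 HL Hs). pose proof (cpar_bounds x0 L H0 HL).
  unfold hpar. apply Rmult_lt_0_compat; [apply Rmult_lt_0_compat|]; lra.
Qed.

Lemma is_derive_theta x0 L s :
  0 < x0 -> 3 * x0 < L -> Rabs (s - L) < kpar x0 L ->
  is_derive (theta x0 L) s (/ hpar x0 L s).
Proof.
  intros H0 HL Hs. pose proof (kpar_gt x0 L H0 HL).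
  pose proof (cos_apar_pos x0 L s H0 HL Hs). pose proof (cpar_bounds x0 L H0 HL).
  evar_last.
  - apply (is_derive_comp (fun a => a / cpar x0 L) (apar x0 L)).
    + auto_derive; [lra|]. reflexivity.
    + now apply is_derive_apar.
  - unfold scal; simpl; unfold mult; simpl. unfold hpar. field. lra.
Qed.

Lemma is_derive_hpar x0 L s :
  0 < x0 -> 3 * x0 < L -> Rabs (s - L) < kpar x0 L ->
  is_derive (hpar x0 L) s
    (- cpar x0 L * (sin (apar x0 L s) / cos (apar x0 L s))).
Proof.
  intros H0 HL Hs. pose proof (kpar_gt x0 L H0 HL).
  pose proof (cos_apar_pos x0 L s H0 HL Hs). pose proof (cpar_bounds x0 L H0 HL).
  evar_last.
  - apply (is_derive_comp (fun a => cpar x0 L * kpar x0 L * cos a) (apar x0 L)).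
    + auto_derive; [exact I|]. reflexivity.
    + now apply is_derive_apar.
  - unfold scal; simpl; unfold mult; simpl. field. lra.
Qed.

(** The two frequencies are [a / c + a] and [a / c - a], so the addition formulas yield
    [cos (a / c) * cos a]; the factor [cos a] cancels against the derivative of [apar]. *)
Lemma is_derive_gx x0 L s :
  0 < x0 -> 3 * x0 < L -> Rabs (s - L) < kpar x0 L ->
  is_derive (gx x0 L) s (- cos (theta x0 L s)).
Proof.
  intros H0 HL Hs. pose proof (kpar_gt x0 L H0 HL). pose proof PI_RGT_0.
  pose proof (cos_apar_pos x0 L s H0 HL Hs). pose proof (cpar_bounds x0 L H0 HL).
  set (c := cpar x0 L) in *. set (k := kpar x0 L) in *.
  assert (HPc : 0 < PI * c) by nra.
  assert (HPc' : PI - PI * c > 0) by nra.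
  evar_last.
  - apply (is_derive_comp (fun a => - (k / 2) * (PI * c / (PI + PI * c) * sin ((PI + PI * c) / (PI * c) * a)
              + PI * c / (PI - PI * c) * sin ((PI - PI * c) / (PI * c) * a))) (apar x0 L)).
    + auto_derive; [exact I|]. reflexivity.
    + now apply is_derive_apar.
  - unfold scal; simpl; unfold mult; simpl. unfold theta.
    fold c. fold k. set (a := apar x0 L s) in *.
    replace ((PI + PI * c) / (PI * c) * a) with (a / c + a) by (field; lra).
    replace ((PI - PI * c) / (PI * c) * a) with (a / c - a) by (field; lra).
    rewrite cos_plus, cos_minus. field. repeat split; lra.
Qed.

Lemma is_derive_gy x0 L s :
  0 < x0 -> 3 * x0 < L -> Rabs (s - L) < kpar x0 L ->
  is_derive (gy x0 L) s (- sin (theta x0 L s)).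
Proof.
  intros H0 HL Hs. pose proof (kpar_gt x0 L H0 HL). pose proof PI_RGT_0.
  pose proof (cos_apar_pos x0 L s H0 HL Hs). pose proof (cpar_bounds x0 L H0 HL).
  set (c := cpar x0 L) in *. set (k := kpar x0 L) in *.
  assert (HPc : 0 < PI * c) by nra.
  assert (HPc' : PI - PI * c > 0) by nra.
  evar_last.
  - apply (is_derive_comp (fun a => (k / 2) * (PI * c / (PI + PI * c) * cos ((PI + PI * c) / (PI * c) * a)
              + PI * c / (PI - PI * c) * cos ((PI - PI * c) / (PI * c) * a))
              + PI * x0 / (PI * c * tan (PI * c))) (apar x0 L)).
    + auto_derive; [exact I|]. reflexivity.
    + now apply is_derive_apar.
  - unfold scal; simpl; unfold mult; simpl. unfold theta.
    fold c. fold k. set (a := apar x0 L s) in *.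
    replace ((PI + PI * c) / (PI * c) * a) with (a / c + a) by (field; lra).
    replace ((PI - PI * c) / (PI * c) * a) with (a / c - a) by (field; lra).
    rewrite sin_plus, sin_minus. field. repeat split; lra.
Qed.

(** With unit tangent T and normal N, the derivative of gamma + phi N is (1 + phi / h) T + phi' N,
    because N' = T / h. *)
Definition dpert1 (x0 L : R) (phi : R -> R) (t : R) : R :=
  - (1 + phi t / hpar x0 L t) * cos (theta x0 L t) - Derive phi t * sin (theta x0 L t).

Definition dpert2 (x0 L : R) (phi : R -> R) (t : R) : R :=
  - (1 + phi t / hpar x0 L t) * sin (theta x0 L t) + Derive phi t * cos (theta x0 L t).

Lemma is_derive_pert x0 L phi s :
  0 < x0 -> 3 * x0 < L -> C2 phi -> Rabs (s - L) < kpar x0 L ->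
  is_derive (pert1 x0 L phi) s (dpert1 x0 L phi s) /\
  is_derive (pert2 x0 L phi) s (dpert2 x0 L phi s).
Proof.
  intros H0 HL Hphi Hs.
  pose proof (is_derive_gx x0 L s H0 HL Hs) as Dx.
  pose proof (is_derive_gy x0 L s H0 HL Hs) as Dy.
  pose proof (is_derive_theta x0 L s H0 HL Hs) as Dth.
  pose proof (hpar_pos x0 L s H0 HL Hs) as Hh.
  destruct (Hphi s) as (Dphi & _ & _).
  pose proof (locally_chart L _ s Hs) as Hloc.
  split.
  - apply (is_derive_ext_loc (fun t => gx x0 L t + phi t * - sin (theta x0 L t))).
    { revert Hloc; apply filter_imp; intros t Ht. unfold pert1. f_equal. f_equal.
      symmetry; apply is_derive_unique. now apply is_derive_gy. }
    auto_derive.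
    + repeat split; eauto; eexists; eauto.
    + replace (Derive (fun t => gx x0 L t) s) with (- cos (theta x0 L s))
        by (symmetry; now apply is_derive_unique).
      replace (Derive (fun t => theta x0 L t) s) with (/ hpar x0 L s)
        by (symmetry; now apply is_derive_unique).
      unfold dpert1. change (Derive (fun t => phi t) s) with (Derive phi s). field. lra.
  - apply (is_derive_ext_loc (fun t => gy x0 L t - phi t * - cos (theta x0 L t))).
    { revert Hloc; apply filter_imp; intros t Ht. unfold pert2. f_equal. f_equal.
      symmetry; apply is_derive_unique. now apply is_derive_gx. }
    auto_derive.
    + repeat split; eauto; eexists; eauto.
    + replace (Derive (fun t => gy x0 L t) s) with (- sin (theta x0 L s))
        by (symmetry; now apply is_derive_unique).
      replace (Derive (fun t => theta x0 L t) s) with (/ hpar x0 L s)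
        by (symmetry; now apply is_derive_unique).
      unfold dpert2. change (Derive (fun t => phi t) s) with (Derive phi s). field. lra.
Qed.

(** Differentiates the frame expression once more, with T' = - N / h and N' = T / h; [p] is the
    tangential component of the velocity and [p'] its derivative. *)
Lemma is_derive_dpert x0 L phi s :
  0 < x0 -> 3 * x0 < L -> C2 phi -> Rabs (s - L) < kpar x0 L ->
  let h := hpar x0 L s in
  let b := - cpar x0 L * (sin (apar x0 L s) / cos (apar x0 L s)) in
  let p := 1 + phi s / h in
  let p' := Derive phi s / h - phi s * b / h ^ 2 in
  let sn := sin (theta x0 L s) in let cs := cos (theta x0 L s) in
  is_derive (dpert1 x0 L phi) s
    (- (p' + Derive phi s / h) * cs + (p / h - Derive (Derive phi) s) * sn) /\
  is_derive (dpert2 x0 L phi) s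
    (- (p' + Derive phi s / h) * sn - (p / h - Derive (Derive phi) s) * cs).
Proof.
  intros H0 HL Hphi Hs h b p p' sn cs.
  pose proof (is_derive_theta x0 L s H0 HL Hs) as Dth.
  pose proof (is_derive_hpar x0 L s H0 HL Hs) as Dh. fold b in Dh.
  pose proof (hpar_pos x0 L s H0 HL Hs) as Hh.
  destruct (Hphi s) as (Dphi & Dphi' & _).
  split; unfold dpert1, dpert2.
  - auto_derive.
    + repeat split; eauto; try lra; eexists; eauto.
    + replace (Derive (fun t => hpar x0 L t) s) with b
        by (symmetry; now apply is_derive_unique).
      replace (Derive (fun t => theta x0 L t) s) with (/ hpar x0 L s)
        by (symmetry; now apply is_derive_unique).
      change (Derive (fun t => phi t) s) with (Derive phi s).
      change (Derive (fun t => Derive phi t) s) with (Derive (Derive phi) s).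
      unfold p', p, h, sn, cs. field. lra.
  - auto_derive.
    + repeat split; eauto; try lra; eexists; eauto.
    + replace (Derive (fun t => hpar x0 L t) s) with b
        by (symmetry; now apply is_derive_unique).
      replace (Derive (fun t => theta x0 L t) s) with (/ hpar x0 L s)
        by (symmetry; now apply is_derive_unique).
      change (Derive (fun t => phi t) s) with (Derive phi s).
      change (Derive (fun t => Derive phi t) s) with (Derive (Derive phi) s).
      unfold p', p, h, sn, cs. field. lra.
Qed.

Lemma chart_interval x0 L s :
  0 < x0 -> 3 * x0 < L -> 0 <= s <= 2 * L -> Rabs (s - L) < kpar x0 L.
Proof.
  intros H0 HL Hs. pose proof (kpar_gt x0 L H0 HL). apply Rabs_lt_between. lra.
Qed.

Lemma Fcal_pert x0 L phi :
  0 < x0 -> 3 * x0 < L -> C2 phi ->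
  Fcal L (pert1 x0 L phi) (pert2 x0 L phi) =
  RInt (fun s => Fdens (hpar x0 L s)
          (- cpar x0 L * (sin (apar x0 L s) / cos (apar x0 L s)))
          (phi s) (Derive phi s) (Derive (Derive phi) s)) 0 (2 * L).
Proof.
  intros H0 HL Hphi. unfold Fcal. apply RInt_ext; intros s.
  rewrite Rmin_left, Rmax_right by lra. intros Hs.
  assert (Hch : Rabs (s - L) < kpar x0 L) by (apply chart_interval; lra).
  destruct (is_derive_pert x0 L phi s H0 HL Hphi Hch) as [D1 D2].
  destruct (is_derive_dpert x0 L phi s H0 HL Hphi Hch) as [DD1 DD2].
  pose proof (hpar_pos x0 L s H0 HL Hch) as Hh.
  (* The first derivatives are identified on a whole neighbourhood, as the second [Derive]
     requires. *)
  assert (Hloc : locally s (fun t => dpert1 x0 L phi t = Derive (pert1 x0 L phi) t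
                                  /\ dpert2 x0 L phi t = Derive (pert2 x0 L phi) t)).
  { generalize (locally_chart L _ s Hch); apply filter_imp; intros t Ht.
    destruct (is_derive_pert x0 L phi t H0 HL Hphi Ht) as [E1 E2].
    split; symmetry; now apply is_derive_unique. }
  assert (DD1' := is_derive_ext_loc _ _ _ _ (filter_imp _ _ (fun t Ht => proj1 Ht) Hloc) DD1).
  assert (DD2' := is_derive_ext_loc _ _ _ _ (filter_imp _ _ (fun t Ht => proj2 Ht) Hloc) DD2).
  cbv zeta.
  rewrite (is_derive_unique _ _ _ D1), (is_derive_unique _ _ _ D2).
  rewrite (is_derive_unique _ _ _ DD1'), (is_derive_unique _ _ _ DD2').
  unfold dpert1, dpert2, Fdens.
  set (b := - cpar x0 L * _). set (h := hpar x0 L s) in *.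
  set (r := Derive phi s). set (w := Derive (Derive phi) s).
  pose proof (sin2_cos2 (theta x0 L s)) as Hsc. unfold Rsqr in Hsc.
  set (sn := sin (theta x0 L s)) in *. set (cs := cos (theta x0 L s)) in *.
  set (p := 1 + phi s / h).
  set (D := p ^ 2 - p * (h * w) + 2 * r ^ 2 - phi s / h * r * b).
  replace ((- p * cs - r * sn) ^ 2 + (- p * sn + r * cs) ^ 2)
    with ((sn * sn + cs * cs) * (p ^ 2 + r ^ 2)) by ring.
  match goal with |- _ / ?d = _ =>
    assert (HD : @eq R d ((sn * sn + cs * cs) * (D / h))) by (unfold D, p; field; lra) end.
  (* Inversion is total with [/ 0 = 0], so the quotient by [D / h] is rearranged without knowing
     that [D] is nonzero. *)
  rewrite HD, Hsc, !Rmult_1_l. unfold Rdiv. rewrite Rinv_mult, Rinv_inv.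
  match goal with |- ?a = ?b => change (@eq R a b) end. ring.
Qed.

Lemma Acal_pert x0 L phi :
  0 < x0 -> 3 * x0 < L -> C2 phi ->
  Acal L (pert1 x0 L phi) (pert2 x0 L phi) =
  / 2 * RInt (fun s => Adens (gx x0 L s) (gy x0 L s) (theta x0 L s) (hpar x0 L s)
                         (phi s) (Derive phi s)) 0 (2 * L).
Proof.
  intros H0 HL Hphi. unfold Acal. f_equal. apply RInt_ext; intros s.
  rewrite Rmin_left, Rmax_right by lra. intros Hs.
  assert (Hch : Rabs (s - L) < kpar x0 L) by (apply chart_interval; lra).
  destruct (is_derive_pert x0 L phi s H0 HL Hphi Hch) as [D1 D2].
  rewrite (is_derive_unique _ _ _ D1), (is_derive_unique _ _ _ D2).
  unfold dpert1, dpert2, Adens, pert1, pert2.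
  rewrite (is_derive_unique _ _ _ (is_derive_gx x0 L s H0 HL Hch)).
  rewrite (is_derive_unique _ _ _ (is_derive_gy x0 L s H0 HL Hch)).
  match goal with |- ?a = ?b => change (@eq R a b) end. ring.
Qed.

Lemma C2_zero : C2 (fun _ => 0).
Proof.
  intros s.
  assert (HD : Derive (fun _ : R => 0) = fun _ => 0)
    by (apply functional_extensionality; intros; apply Derive_const).
  rewrite !HD. repeat split; try apply ex_derive_const. apply continuous_const.
Qed.

Lemma pert1_zero x0 L : pert1 x0 L (fun _ => 0) = gx x0 L.
Proof. apply functional_extensionality; intros s; unfold pert1; ring. Qed.

Lemma pert2_zero x0 L : pert2 x0 L (fun _ => 0) = gy x0 L.
Proof. apply functional_extensionality; intros s; unfold pert2; ring. Qed.

(** * Change of variables from arc length to tangent angle *)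

(** Inverse of [theta]: the arc length at which the tangent angle is [z]. *)
Definition arcpos (x0 L z : R) : R := L + kpar x0 L * sin (cpar x0 L * z).

Lemma angle_range x0 L z :
  0 < x0 -> 3 * x0 < L -> - PI <= z <= PI ->
  - Defs.sigma x0 L <= cpar x0 L * z <= Defs.sigma x0 L.
Proof.
  intros H0 HL Hz. pose proof (cpar_bounds x0 L H0 HL).
  change (Defs.sigma x0 L) with (PI * cpar x0 L). nra.
Qed.

Lemma apar_arcpos x0 L z :
  0 < x0 -> 3 * x0 < L -> - PI <= z <= PI -> apar x0 L (arcpos x0 L z) = cpar x0 L * z.
Proof.
  intros H0 HL Hz. pose proof (kpar_gt x0 L H0 HL).
  pose proof (angle_range x0 L z H0 HL Hz). pose proof (sigma_bounds x0 L H0 HL).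
  unfold apar, arcpos.
  replace ((L + kpar x0 L * sin (cpar x0 L * z) - L) / kpar x0 L)
    with (sin (cpar x0 L * z)) by (field; lra).
  apply asin_sin; lra.
Qed.

Lemma arcpos_range x0 L z :
  0 < x0 -> 3 * x0 < L -> - PI <= z <= PI -> 0 <= arcpos x0 L z <= 2 * L.
Proof.
  intros H0 HL Hz. pose proof (kpar_gt x0 L H0 HL).
  pose proof (angle_range x0 L z H0 HL Hz). pose proof (sigma_bounds x0 L H0 HL).
  pose proof (kpar_sin x0 L H0 HL) as Hks. unfold arcpos.
  assert (sin (cpar x0 L * z) <= sin (Defs.sigma x0 L)) by (apply sin_incr_1; lra).
  assert (sin (- Defs.sigma x0 L) <= sin (cpar x0 L * z)) by (apply sin_incr_1; lra).
  rewrite sin_neg in *. nra.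
Qed.

Lemma arcpos_left x0 L : 0 < x0 -> 3 * x0 < L -> arcpos x0 L (- PI) = 0.
Proof.
  intros H0 HL. pose proof (kpar_sin x0 L H0 HL) as Hks. unfold arcpos.
  replace (cpar x0 L * - PI) with (- Defs.sigma x0 L)
    by (change (Defs.sigma x0 L) with (PI * cpar x0 L); ring).
  rewrite sin_neg. lra.
Qed.

Lemma arcpos_right x0 L : 0 < x0 -> 3 * x0 < L -> arcpos x0 L PI = 2 * L.
Proof.
  intros H0 HL. pose proof (kpar_sin x0 L H0 HL) as Hks. unfold arcpos.
  replace (cpar x0 L * PI) with (Defs.sigma x0 L)
    by (change (Defs.sigma x0 L) with (PI * cpar x0 L); ring).
  lra.
Qed.

Lemma is_derive_arcpos x0 L z :
  is_derive (arcpos x0 L) z (cpar x0 L * kpar x0 L * cos (cpar x0 L * z)).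
Proof. unfold arcpos. auto_derive; [exact I|]. ring. Qed.

Lemma arcpos_surj x0 L s :
  0 < x0 -> 3 * x0 < L -> 0 <= s <= 2 * L ->
  exists z, - PI <= z <= PI /\ arcpos x0 L z = s.
Proof.
  intros H0 HL Hs. pose proof PI_RGT_0.
  destruct (IVT_gen (arcpos x0 L) (- PI) PI s) as [z [Hz Hzs]].
  - intros z. apply continuity_pt_filterlim.
    eapply is_derive_cont, is_derive_arcpos.
  - rewrite arcpos_left, arcpos_right by assumption.
    rewrite Rmin_left, Rmax_right; lra.
  - rewrite Rmin_left, Rmax_right in Hz by lra. eauto.
Qed.

Lemma RInt_arcpos x0 L (F : R -> R) :
  0 < x0 -> 3 * x0 < L ->
  (forall s, 0 <= s <= 2 * L -> continuous F s) ->
  RInt F 0 (2 * L) =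
  RInt (fun z => cpar x0 L * kpar x0 L * cos (cpar x0 L * z) * F (arcpos x0 L z)) (- PI) PI.
Proof.
  intros H0 HL HF. pose proof PI_RGT_0.
  rewrite <- (arcpos_left x0 L H0 HL), <- (arcpos_right x0 L H0 HL).
  symmetry.
  apply (RInt_comp F (arcpos x0 L)
    (fun z => cpar x0 L * kpar x0 L * cos (cpar x0 L * z)));
    rewrite Rmin_left, Rmax_right by lra; intros z Hz.
  - apply HF, arcpos_range; auto.
  - split; [apply is_derive_arcpos|]. cont.
Qed.

Lemma hpar_arcpos x0 L z :
  0 < x0 -> 3 * x0 < L -> - PI <= z <= PI ->
  hpar x0 L (arcpos x0 L z) = cpar x0 L * kpar x0 L * cos (cpar x0 L * z).
Proof. intros; unfold hpar; now rewrite apar_arcpos. Qed.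

Lemma theta_arcpos x0 L z :
  0 < x0 -> 3 * x0 < L -> - PI <= z <= PI -> theta x0 L (arcpos x0 L z) = z.
Proof.
  intros H0 HL Hz. pose proof (cpar_bounds x0 L H0 HL).
  unfold theta. rewrite apar_arcpos by assumption. field. lra.
Qed.

(** Here [c ^ 2 = x0 / (L + x0)]. This is the value of the multiplier for which the first variation
    vanishes in [gap_in_angle]. *)
Lemma half_lambda x0 L :
  0 < x0 -> 3 * x0 < L -> lambda x0 L = 2 * (1 - cpar x0 L ^ 2).
Proof.
  intros H0 HL. unfold lambda, cpar.
  assert (0 < x0 / (L + x0)) by (apply Rdiv_lt_0_compat; lra).
  rewrite <- Rsqr_pow2, Rsqr_sqrt by lra. field. lra.
Qed.

(** Positivity of the denominator makes the integrand of F continuous, which justifies both the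
    linearity of the integral and the substitution. *)
Lemma functional_in_angle x0 L phi :
  0 < x0 -> 3 * x0 < L -> C2 phi ->
  let c := cpar x0 L in
  let h := fun z => c * kpar x0 L * cos (c * z) in
  let b := fun z => - c * (sin (c * z) / cos (c * z)) in
  let f := fun z => phi (arcpos x0 L z) in
  let r := fun z => Derive phi (arcpos x0 L z) in
  let v := fun z => Derive (Derive phi) (arcpos x0 L z) in
  (forall z, - PI <= z <= PI ->
     0 < (1 + f z / h z) ^ 2 - (1 + f z / h z) * (h z * v z) + 2 * r z ^ 2
         - f z / h z * r z * b z) ->
  Fcal L (pert1 x0 L phi) (pert2 x0 L phi)
    - lambda x0 L * Acal L (pert1 x0 L phi) (pert2 x0 L phi)
  = RInt (fun z => h z * (Fdens (h z) (b z) (f z) (r z) (v z)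
        - (1 - c ^ 2) * Adens (gx x0 L (arcpos x0 L z)) (gy x0 L (arcpos x0 L z))
                              z (h z) (f z) (r z))) (- PI) PI.
Proof.
  intros H0 HL Hphi c h b f r v Hden. pose proof PI_RGT_0 as HPI.
  rewrite Fcal_pert, Acal_pert, half_lambda by assumption. fold c.
  set (Fd := fun s => Fdens (hpar x0 L s) (- c * (sin (apar x0 L s) / cos (apar x0 L s)))
                        (phi s) (Derive phi s) (Derive (Derive phi) s)).
  set (Ad := fun s => Adens (gx x0 L s) (gy x0 L s) (theta x0 L s) (hpar x0 L s)
                        (phi s) (Derive phi s)).
  assert (Cphi : forall s, continuous phi s)
    by (intros s; apply (ex_derive_continuous phi), Hphi).
  assert (Cphi1 : forall s, continuous (Derive phi) s)
    by (intros s; apply (ex_derive_continuous (Derive phi)), Hphi).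
  assert (Cphi2 : forall s, continuous (Derive (Derive phi)) s) by apply Hphi.
  assert (Cth : forall s, 0 <= s <= 2 * L -> continuous (theta x0 L) s)
    by (intros s Hs; eapply is_derive_cont, is_derive_theta; auto; now apply chart_interval).
  assert (Ch : forall s, 0 <= s <= 2 * L -> continuous (hpar x0 L) s)
    by (intros s Hs; eapply is_derive_cont, is_derive_hpar; auto; now apply chart_interval).
  assert (Ca : forall s, 0 <= s <= 2 * L -> continuous (apar x0 L) s)
    by (intros s Hs; eapply is_derive_cont, is_derive_apar; auto; now apply chart_interval).
  assert (Cx : forall s, 0 <= s <= 2 * L -> continuous (gx x0 L) s)
    by (intros s Hs; eapply is_derive_cont, is_derive_gx; auto; now apply chart_interval).
  assert (Cy : forall s, 0 <= s <= 2 * L -> continuous (gy x0 L) s)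
    by (intros s Hs; eapply is_derive_cont, is_derive_gy; auto; now apply chart_interval).
  assert (CAd : forall s, 0 <= s <= 2 * L -> continuous Ad s).
  { intros s Hs. pose proof (hpar_pos x0 L s H0 HL (chart_interval _ _ _ H0 HL Hs)).
    unfold Ad, Adens. cont; lra. }
  assert (CFd : forall s, 0 <= s <= 2 * L -> continuous Fd s).
  { intros s Hs. pose proof (hpar_pos x0 L s H0 HL (chart_interval _ _ _ H0 HL Hs)).
    pose proof (cos_apar_pos x0 L s H0 HL (chart_interval _ _ _ H0 HL Hs)).
    (* Positivity is assumed in the angle; every [s] in the interval is reached by some [z]. *)
    destruct (arcpos_surj x0 L s H0 HL Hs) as [z [Hz Hzs]].
    specialize (Hden z Hz). unfold f, r, v, h, b, c in Hden.
    rewrite <- hpar_arcpos, <- apar_arcpos, Hzs in Hden by assumption. fold c in Hden.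
    unfold Fd, Fdens. cont; lra. }
  replace (RInt Fd 0 (2 * L) - 2 * (1 - c ^ 2) * (/ 2 * RInt Ad 0 (2 * L)))
    with (RInt (fun s => Fd s - (1 - c ^ 2) * Ad s) 0 (2 * L)).
  - rewrite (RInt_arcpos x0) by (try assumption; intros; cont).
    apply RInt_ext; intros z. rewrite Rmin_left, Rmax_right by lra. intros Hz.
    unfold Fd, Ad. rewrite hpar_arcpos, theta_arcpos, apar_arcpos by (auto; lra).
    reflexivity.
  - rewrite RInt_Rminus, RInt_Rscal by (try lra; intros; cont).
    match goal with |- ?a = ?b => change (@eq R a b) end. field.
Qed.

(** The case phi = 0, where the quotient in [Fdens] equals 1. *)
Lemma functional_at_gamma x0 L :
  0 < x0 -> 3 * x0 < L ->
  let c := cpar x0 L in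
  let h := fun z => c * kpar x0 L * cos (c * z) in
  Fcal L (gx x0 L) (gy x0 L) - lambda x0 L * Acal L (gx x0 L) (gy x0 L)
  = RInt (fun z => h z * (h z - (1 - c ^ 2)
       * Adens (gx x0 L (arcpos x0 L z)) (gy x0 L (arcpos x0 L z)) z (h z) 0 0)) (- PI) PI.
Proof.
  intros H0 HL c h. pose proof PI_RGT_0 as HPI.
  assert (HD : Derive (fun _ : R => 0) = fun _ => 0)
    by (apply functional_extensionality; intros; apply Derive_const).
  pose proof (functional_in_angle x0 L (fun _ => 0) H0 HL C2_zero) as H.
  rewrite pert1_zero, pert2_zero, !HD in H. cbv zeta in H. rewrite H.
  - apply RInt_ext; intros z _. fold c. unfold h, Fdens, Rdiv.
    rewrite !Rmult_0_l. f_equal. f_equal.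
    match goal with |- ?a = ?b => change (@eq R a b) end. field.
  - intros z Hz. unfold Rdiv. rewrite !Rmult_0_l, !Rmult_0_r. lra.
Qed.

(** * Choice of epsilon and conclusion *)

Theorem mainTheorem20 (x0 A0 L : R) :
  0 < x0 -> 3 / 2 * PI * x0 ^ 2 < A0 ->
  3 * x0 < L -> Acal L (gx x0 L) (gy x0 L) = A0 ->
  exists eps : R, 0 < eps /\
    forall phi : R -> R,
      C2 phi -> W1_bc L phi ->
      (exists s, 0 <= s <= 2 * L /\ phi s <> 0) ->
      (forall s, 0 <= s <= 2 * L ->
         Rabs (phi s) <= eps /\ Rabs (Derive phi s) <= eps /\
         Rabs (Derive (Derive phi) s) <= eps) ->
      Fcal L (gx x0 L) (gy x0 L) - lambda x0 L * Acal L (gx x0 L) (gy x0 L)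
        < Fcal L (pert1 x0 L phi) (pert2 x0 L phi)
          - lambda x0 L * Acal L (pert1 x0 L phi) (pert2 x0 L phi)
      /\ (Acal L (pert1 x0 L phi) (pert2 x0 L phi) = Acal L (gx x0 L) (gy x0 L) ->
          Fcal L (gx x0 L) (gy x0 L) < Fcal L (pert1 x0 L phi) (pert2 x0 L phi)).
Proof.
  intros H0 _ HL _. pose proof PI_RGT_0 as HPI.
  pose proof (kpar_gt x0 L H0 HL) as Hk.
  pose proof (cpar_bounds x0 L H0 HL) as Hc.
  pose proof (sigma_bounds x0 L H0 HL) as Hsg.
  set (c := cpar x0 L) in *. set (k := kpar x0 L) in *.
  (* Smallest value of [cos (c * z)] on [[- PI, PI]]. Hence [c * k * m <= h <= c * k], and [B = / m]
     bounds [b]. *)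
  set (m := cos (Defs.sigma x0 L)).
  assert (Hm : 0 < m) by (apply cos_gt_0; lra).
  assert (Hck : 0 < c * k) by (apply Rmult_lt_0_compat; lra).
  assert (Hckm : 0 < c * k * m) by now apply Rmult_lt_0_compat.
  set (B := / m).
  assert (HB : 0 < B) by now apply Rinv_0_lt_compat.
  set (N := 2 + 6 * PI * exp (2 * PI)).
  assert (HN : 1 <= N).
  { unfold N. pose proof (exp_pos (2 * PI)).
    assert (0 < PI * exp (2 * PI)) by now apply Rmult_lt_0_compat. lra. }
  set (K := (4 + 3 * B) * (2 + 2 * B ^ 2) * N).
  assert (HK : 4 + 3 * B <= K).
  { unfold K. pose proof (pow2_ge_0 B).
    assert (4 + 3 * B <= (4 + 3 * B) * (2 + 2 * B ^ 2)) by nra. nra. }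
  (* Gives [d * K = c ^ 2 / 2], half of what [gap_in_angle] tolerates. *)
  set (d := c ^ 2 / (2 * K)).
  assert (Hc2 : 0 < c ^ 2 < 1) by (split; [apply pow_lt; lra|nra]).
  assert (Hd : 0 < d) by (apply Rdiv_lt_0_compat; lra).
  assert (HdK : d * K < c ^ 2).
  { replace (d * K) with (c ^ 2 / 2) by (unfold d; field; lra). lra. }
  (* The summands are the factors by which a C^2 bound on phi is multiplied to bound phi', phi / h
     and h phi'' respectively. *)
  set (M := 1 + / (c * k * m) + c * k).
  assert (HMi : 0 < / (c * k * m)) by now apply Rinv_0_lt_compat.
  assert (HM : 0 < M) by (unfold M; lra).
  exists (d / M). split; [now apply Rdiv_lt_0_compat|].
  intros phi Hphi (P0 & P1 & P2 & P3) (s1 & Hs1 & Hphi1) Hsmall.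
  assert (HdM : 0 < d / M) by now apply Rdiv_lt_0_compat.
  assert (HdMM : d / M * M = d) by (field; lra).
  set (h := fun z => c * k * cos (c * z)).
  set (b := fun z => - c * (sin (c * z) / cos (c * z))).
  set (f := fun z => phi (arcpos x0 L z)).
  set (r := fun z => Derive phi (arcpos x0 L z)).
  set (v := fun z => Derive (Derive phi) (arcpos x0 L z)).
  assert (Hcos : forall z, - PI <= z <= PI -> m <= cos (c * z)).
  { intros z Hz. pose proof (angle_range x0 L z H0 HL Hz) as Hr. fold c in Hr.
    destruct (Rle_lt_dec 0 (c * z)).
    - apply cos_decr_1; lra.
    - rewrite <- (cos_neg (c * z)). apply cos_decr_1; lra. }
  assert (Hh : forall z, - PI <= z <= PI -> c * k * m <= h z <= c * k).
  { intros z Hz. specialize (Hcos z Hz). pose proof (COS_bound (c * z)).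
    unfold h. split; [|rewrite <- (Rmult_1_r (c * k)) at 2];
      apply Rmult_le_compat_l; lra. }
  assert (Hbd : forall z, - PI <= z <= PI -> Rabs (f z / h z) <= d /\ Rabs (r z) <= d /\
     Rabs (h z * v z) <= d /\ Rabs (b z) <= B).
  { intros z Hz. destruct (Hsmall _ (arcpos_range x0 L z H0 HL Hz)) as (S1 & S2 & S3).
    specialize (Hh z Hz). specialize (Hcos z Hz).
    assert (Hinv : Rabs (/ h z) <= / (c * k * m)).
    { rewrite Rabs_right by (apply Rle_ge; left; apply Rinv_0_lt_compat; lra).
      apply Rinv_le_contravar; lra. }
    assert (Hhz : Rabs (h z) <= c * k) by (rewrite Rabs_right; lra).
    repeat split.
    - apply Rle_trans with (d / M * / (c * k * m)); [now apply Rabs_mult_le|].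
      rewrite <- HdMM at 2. apply Rmult_le_compat_l; [lra|unfold M; lra].
    - apply Rle_trans with (d / M * 1); [rewrite Rmult_1_r; exact S2|].
      rewrite <- HdMM at 2. apply Rmult_le_compat_l; [lra|unfold M; lra].
    - apply Rle_trans with (c * k * (d / M)); [now apply Rabs_mult_le|].
      rewrite <- HdMM at 2. rewrite Rmult_comm. apply Rmult_le_compat_l; [lra|unfold M; lra].
    - unfold b, Rdiv. replace B with (1 * (1 * B)) by ring.
      apply Rabs_mult_le; [rewrite Rabs_Ropp, Rabs_right; lra|].
      apply Rabs_mult_le.
      + apply Rabs_le, SIN_bound.
      + rewrite Rabs_right by (apply Rle_ge; left; apply Rinv_0_lt_compat; lra).
        unfold B. apply Rinv_le_contravar; lra. }
  assert (HdB : d * (4 + 3 * B) < 1).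
  { apply Rle_lt_trans with (d * K); [apply Rmult_le_compat_l|]; lra. }
  assert (Hgap : Fcal L (gx x0 L) (gy x0 L) - lambda x0 L * Acal L (gx x0 L) (gy x0 L)
        < Fcal L (pert1 x0 L phi) (pert2 x0 L phi)
          - lambda x0 L * Acal L (pert1 x0 L phi) (pert2 x0 L phi)).
  { rewrite functional_at_gamma by assumption.
    rewrite functional_in_angle; try assumption.
    - apply (gap_in_angle c k d B (fun z => gx x0 L (arcpos x0 L z))
               (fun z => gy x0 L (arcpos x0 L z)) f r v); try lra.
      + intros z Hz. specialize (Hcos z Hz). lra.
      + intros z Hz. evar_last.
        * apply (is_derive_comp (gx x0 L) (arcpos x0 L)); [|apply is_derive_arcpos].
          apply is_derive_gx; auto. now apply chart_interval, arcpos_range.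
        * rewrite theta_arcpos by assumption. apply Rmult_comm.
      + intros z Hz. evar_last.
        * apply (is_derive_comp (gy x0 L) (arcpos x0 L)); [|apply is_derive_arcpos].
          apply is_derive_gy; auto. now apply chart_interval, arcpos_range.
        * rewrite theta_arcpos by assumption. apply Rmult_comm.
      + intros z. apply (is_derive_comp phi (arcpos x0 L)); [|apply is_derive_arcpos].
        apply Derive_correct, Hphi.
      + intros z. apply (is_derive_comp (Derive phi) (arcpos x0 L));
          [|apply is_derive_arcpos].
        apply Derive_correct, Hphi.
      + intros z. apply (continuous_comp (arcpos x0 L) (Derive (Derive phi))).
        * eapply is_derive_cont, is_derive_arcpos.
        * apply Hphi.
      + unfold f. now rewrite arcpos_left.
      + unfold f. now rewrite arcpos_right.
      + unfold r. now rewrite arcpos_left.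
      + unfold r. now rewrite arcpos_right.
      + destruct (arcpos_surj x0 L s1 H0 HL Hs1) as [z [Hz Hzs]].
        exists z. split; [exact Hz|]. unfold f. now rewrite Hzs.
      + exact Hbd.
      + replace (d * (4 + 3 * B) * (2 + 2 * B ^ 2) * (2 + 6 * PI * exp (2 * PI)))
          with (d * K) by (unfold K, N; ring). exact HdK.
    - intros z Hz. destruct (Hbd z Hz) as (b1 & b2 & b3 & b4).
      exact (speed_quotient_denominator_pos _ _ _ _ _ _ b1 b2 b3 b4 HdB). }
  split; [exact Hgap|].
  intros HA. rewrite HA in Hgap. lra.
Qed.
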